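(* Let $n\ge 2$ and let $n_0,\ldots,n_{n-1}$ be nonnegative integers with $\sum_i n_i=n$. Let $t>0$ be a constant and $L=\log^{t+2}n$. For $0\le i\le n-1$ let $e(i)$ be $\log\frac{n}{n_i}$ rounded up to a multiple of $1/L$ if $n_i>0$, and $\log n$ rounded up to a multiple of $1/L$ if $n_i=0$. Let $\Sigma=\{i\le n-1 : n_i>0\}$. For an ordered tree $S$ with at most $n$ nodes let $H(S)=\sum_{j=1}^{|S|} e(\deg(x_j))$, where $x_j$ is the $j$-th node of $S$ in preorder and $\deg$ denotes the number of children. Call $S$ a $\Sigma$-tree if every node of $S$ other than possibly the root has number of children in $\Sigma$. Then for every $m\le n$ and every $a\ge 0$, the number of $\Sigma$-trees $S$ with $m$ nodes and $H(S)=a$ is at most $2^{a+1}$.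
   Context: Ordered trees are rooted trees with ordered children; trees are counted up to isomorphism of ordered trees. Logarithms are base $2$. *)

(* Defs.v *)
From HB Require Import structures.
From mathcomp Require Import all_boot all_order all_algebra finmap.
From mathcomp Require Import all_classical all_reals all_analysis.

Set Implicit Arguments.
Unset Strict Implicit.
Unset Printing Implicit Defensive.

Import Order.TTheory GRing.Theory Num.Theory.

Local Open Scope ring_scope.

(* In this representation Leibniz equality is isomorphism of ordered trees. *)
Inductive otree : Type := Node of seq otree.

Fixpoint otree_encode (S : otree) : GenTree.tree void :=
  let: Node cs := S in GenTree.Node 0 (map otree_encode cs).

Fixpoint otree_decode (g : GenTree.tree void) : otree :=
  match g with
  | GenTree.Leaf _ => Node [::]
  | GenTree.Node _ gs => Node (map otree_decode gs)
  end.

Lemma otree_encodeK : cancel otree_encode otree_decode.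
Proof.
rewrite /cancel; fix IH 1 => -[cs] /=; congr Node.
by elim: cs => //= c cs ->; rewrite IH.
Qed.

HB.instance Definition _ := Countable.copy otree (can_type otree_encodeK).

Definition children (S : otree) : seq otree := let: Node cs := S in cs.

Definition deg (S : otree) : nat := size (children S).

(* A node is represented by the subtree it roots; identical subtrees at
   different positions give separate entries of the list. *)
Fixpoint preorder (S : otree) : seq otree :=
  let: Node cs := S in S :: flatten (map preorder cs).

Definition nb_nodes (S : otree) : nat := size (preorder S).

(* The head of [preorder S] is the root, so [behead] keeps the other nodes. *)
Definition sigma_tree (Sigma : pred nat) (S : otree) : bool :=
  all (fun x => Sigma (deg x)) (behead (preorder S)).

Definition log2 (R : realType) (x : R) : R := ln x / ln 2.

Definition round_up (R : realType) (L x : R) : R := (Num.ceil (x * L))%:~R / L.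

Definition logpow (R : realType) (n : nat) (t : R) : R := log2 n%:R `^ (t + 2).

(* The family n_0, ..., n_(n-1) is given as [nn : nat -> nat], of which only
   the values below [n] matter: a node of a tree with at most [n] nodes has
   fewer than [n] children. *)
Definition e (R : realType) (n : nat) (nn : nat -> nat) (t : R) (i : nat)
  : R :=
  round_up (logpow n t)
    (if (0 < nn i)%N then log2 (n%:R / (nn i)%:R) else log2 n%:R).

Definition H (R : realType) (n : nat) (nn : nat -> nat) (t : R) (S : otree)
  : R :=
  \sum_(x <- preorder S) e n nn t (deg x).

Definition Sigma (n : nat) (nn : nat -> nat) : pred nat :=
  fun i => (i < n)%N && (0 < nn i)%N.

(* Main.v *)
(** The preorder sequence of degrees determines an ordered tree. Give a tree
    [S] the weight [2^(-H S)], the product of [q i = 2^(-e i)] over its degree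
    sequence. Rounding up only decreases [q], so [q i <= n_i / n] when
    [n_i > 0] and [q i <= 1 / n] otherwise. Expanding a product of sums over
    all degree sequences, the total weight of the [Sigma]-trees with [m] nodes
    is at most a factor [\sum_(i < n) q i <= 1 + 1] for the root times
    [m - 1] factors [\sum_(i in Sigma) q i <= 1]. Trees with [H S = a] weigh
    [2^(-a)] each. *)

Require Import Defs.
From HB Require Import structures.
From mathcomp Require Import all_boot all_order all_algebra finmap.
From mathcomp Require Import all_classical all_reals all_analysis.

Set Implicit Arguments.
Unset Strict Implicit.
Unset Printing Implicit Defensive.

Import Order.TTheory GRing.Theory Num.Theory.

Local Open Scope classical_set_scope.
Local Open Scope ring_scope.

(* The generated induction principle has no hypothesis on the children. *)
Lemma otree_nested_ind (P : otree -> Prop) :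
  (forall cs, {in cs, forall c, P c} -> P (Node cs)) -> forall S, P S.
Proof.
move=> Pnode.
(* Both list cases are settled before [fix], so that the recursive call in the final term is visibly
   made on the child [c] alone. *)
have Pnil : {in [::], forall c, P c} by [].
have Pcons c cs : P c -> {in cs, forall c, P c} -> {in c :: cs, forall c, P c}.
  by move=> Pc Pcs x; rewrite inE => /predU1P[->//|/Pcs].
fix IH 1 => -[cs]; apply: Pnode.
elim: cs => [|c cs IHcs]; [exact: Pnil | exact: (Pcons c cs (IH c) IHcs)].
Qed.

Definition degs (S : otree) : seq nat := map deg (preorder S).

Lemma degs_Node cs : degs (Node cs) = size cs :: flatten (map degs cs).
Proof. by rewrite /degs /= map_flatten -map_comp. Qed.

Lemma size_degs S : size (degs S) = nb_nodes S.
Proof. exact: size_map. Qed.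

(** Degree sequences form a prefix code. The tails [r] and [r'] carry the induction: once the first
    child is matched, the sequences of its siblings belong to the tail. *)
Lemma degs_catI S S' r r' : degs S ++ r = degs S' ++ r' -> S = S' /\ r = r'.
Proof.
elim/otree_nested_ind: S S' r r' => cs IH [cs'] r r'.
rewrite !degs_Node /= => -[size_eq].
elim: cs cs' size_eq IH r r' => [|c cs IHcs] [|c' cs'] //= [size_eq] IH r r'.
rewrite -!catA => /(IH c (mem_head _ _))[<-] /IHcs[//|x xcs|[->] ->] //.
by apply: IH; rewrite inE xcs orbT.
Qed.

Lemma degs_inj : injective degs.
Proof.
move=> S S' eqSS'.
by have [] := @degs_catI S S' [::] [::]; rewrite ?eqSS'.
Qed.

(** Each child of the root contributes at least one node, and the root itself makes the bound
    strict. Hence degrees fit in a finite ordinal type. *)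
Lemma degs_lt_nb_nodes S d : d \in degs S -> (d < nb_nodes S)%N.
Proof.
rewrite -size_degs; elim/otree_nested_ind: S d => cs IH d.
rewrite degs_Node /= inE ltnS size_flatten /shape -map_comp sumnE big_map.
move=> /predU1P[->|/flatten_mapP[c ccs /(IH _ ccs) d_lt]].
  rewrite -sum1_size leq_sum // => c _.
  by case: c.
apply: leq_trans (ltnW d_lt) _.
by rewrite (big_rem c) //= leq_addr.
Qed.

(* Only meant for trees with [m] nodes, where [m <= n.+1]. *)
Definition degs_ffun (n m : nat) (S : otree) : {ffun 'I_m -> 'I_n.+1} :=
  [ffun i : 'I_m => inord (nth 0%N (degs S) i)].

Lemma degs_ffunE (n m : nat) (S : otree) (i : 'I_m) :
  (m <= n.+1)%N -> nb_nodes S = m ->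
  degs_ffun n m S i = nth 0%N (degs S) i :> nat.
Proof.
move=> m_le Sm; rewrite ffunE inordK //; apply: leq_trans m_le.
by rewrite -[in ltnRHS]Sm degs_lt_nb_nodes // mem_nth // size_degs Sm.
Qed.

Lemma degs_ffun_inj (n m : nat) (S S' : otree) : (m <= n.+1)%N ->
  nb_nodes S = m -> nb_nodes S' = m ->
  degs_ffun n m S = degs_ffun n m S' -> S = S'.
Proof.
move=> m_le Sm S'm eqSS'; apply: degs_inj.
apply: (@eq_from_nth _ 0%N) => [|i]; rewrite !size_degs ?Sm // => i_lt.
by rewrite -!(degs_ffunE (Ordinal i_lt) m_le) // eqSS'.
Qed.

Lemma finite_nb_nodes (m : nat) : finite_set [set S | nb_nodes S = m].
Proof.
have /eq_finite_set <- : (degs_ffun m m @` [set S | nb_nodes S = m]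
    #= [set S | nb_nodes S = m])%card.
  apply: inj_card_eq => S S'; rewrite !inE /= => Sm S'm.
  exact: degs_ffun_inj.
exact: finite_finset.
Qed.

Lemma sigma_tree_degs (P : pred nat) (S : otree) :
  sigma_tree P S = all P (behead (degs S)).
Proof. by rewrite /sigma_tree /degs behead_map all_map. Qed.

Lemma sum_sigma_tree_le (R : realType) (P : pred nat) (q : nat -> R)
    (n m : nat) (s : seq otree) :
  (forall i, 0 <= q i) -> (m < n)%N -> uniq s ->
  {in s, forall S, nb_nodes S = m.+1 /\ sigma_tree P S} ->
  \sum_(S <- s) \prod_(d <- degs S) q d <=
    (\sum_(i < n) q i) * (\sum_(i < n | P i) q i) ^+ m.
Proof.
case: n => // n q_ge0 m_lt uniq_s sP.
(* Position [0] is the root, whose degree is free. Elsewhere forbidden degrees get weight [0], so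
   that every factor sums over the same index type and the product distributes over functions. *)
pose F (i : 'I_m.+1) (j : 'I_n.+1) : R :=
  if (i == ord0) || P j then q j else 0.
have F_ge0 i j : 0 <= F i j by rewrite /F; case: ifP.
have -> : (\sum_(i < n.+1) q i) * (\sum_(i < n.+1 | P i) q i) ^+ m =
    \prod_i \sum_j F i j.
  rewrite [RHS]big_ord_recl; congr (_ * _).
  rewrite -[in LHS](card_ord m) -prodr_const.
  by apply: eq_bigr => i _; rewrite big_mkcond.
rewrite bigA_distr_bigA /=.
have -> : \sum_(S <- s) \prod_(d <- degs S) q d =
    \sum_(f <- map (degs_ffun n m.+1) s) \prod_i F i (f i).
  rewrite big_map; apply: eq_big_seq => S /sP[Sm].
  rewrite sigma_tree_degs => /(all_nthP 0%N) SP.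
  rewrite (big_nth 0%N) size_degs Sm big_mkord; apply: eq_bigr => i _.
  rewrite /F degs_ffunE //; case: ifPn => // /norP[i_neq0] /negP[].
  (* Dropping the root shifts positions by one, hence [i.-1] with [i] nonzero. *)
  have := SP i.-1; rewrite nth_behead size_behead size_degs Sm /=.
  case: i i_neq0 => -[//|i] /= i_lt _; exact.
(* Distinct trees select distinct terms of the expansion; the terms left over are nonnegative. *)
rewrite big_uniq /=; last first.
  rewrite map_inj_in_uniq // => S S' /sP[Sm _] /sP[S'm _].
  exact: degs_ffun_inj.
rewrite [leRHS](bigID (mem (map (degs_ffun n m.+1) s))) /= lerDl.
by apply: sumr_ge0 => f _; apply: prodr_ge0.
Qed.

Section weights.
Variables (R : realType) (n : nat) (nn : nat -> nat) (t : R).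
Hypotheses (n_ge2 : (2 <= n)%N) (sum_nn : (\sum_(i < n) nn i)%N = n).

Let q (i : nat) : R := 2 `^ (- e n nn t i).

Let n_gt0 : 0 < n%:R :> R. Proof. by rewrite ltr0n; case: n n_ge2. Qed.

Lemma le_round_up (L x : R) : 0 < L -> x <= round_up L x.
Proof. by move=> L_gt0; rewrite /round_up ler_pdivlMr // ceil_ge. Qed.

Lemma logpow_gt0 : 0 < logpow n t.
Proof.
by rewrite /logpow powR_gt0 // /log2 divr_gt0 // ln_gt0 // ltr1n.
Qed.

Lemma powR2_log2 (x : R) : 0 < x -> 2 `^ log2 x = x.
Proof.
move=> x_gt0; rewrite /powR pnatr_eq0 /= /log2 divfK ?lnK //.
by rewrite gt_eqF // ln_gt0 // ltr1n.
Qed.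

Lemma powR2_round_up_le (x : R) : 0 < x ->
  2 `^ (- round_up (logpow n t) (log2 x)) <= x^-1.
Proof.
move=> x_gt0; rewrite powRN lef_pV2 ?posrE ?powR_gt0 //.
rewrite -[leLHS]powR2_log2 // ler_powR ?ler1n //.
exact/le_round_up/logpow_gt0.
Qed.

Lemma weight_le_pos i : (0 < nn i)%N -> q i <= (nn i)%:R / n%:R.
Proof.
move=> nni_gt0; rewrite /q /e nni_gt0 -[leRHS]invf_div.
by apply: powR2_round_up_le; rewrite divr_gt0 // ltr0n.
Qed.

(** A single bound for both cases of [e]: the extra [1 / n] covers the degrees with [nn i = 0] and
    adds up to only [1] over all [i < n]. *)
Lemma weight_le i : q i <= (nn i)%:R / n%:R + n%:R^-1.
Proof.
have [nni_gt0|] := boolP (0 < nn i)%N.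
  by apply: le_trans (weight_le_pos nni_gt0) _; rewrite lerDl invr_ge0 ltW.
rewrite lt0n negbK => /eqP nni0; rewrite /q /e nni0 /= mul0r add0r.
exact: powR2_round_up_le.
Qed.

Lemma sum_frequencies : \sum_(i < n) (nn i)%:R / n%:R = 1 :> R.
Proof. by rewrite -mulr_suml -natr_sum sum_nn divff ?gt_eqF. Qed.

Lemma sum_weight_le2 : \sum_(i < n) q i <= 2.
Proof.
apply: (@le_trans _ _ (\sum_(i < n) ((nn i)%:R / n%:R + n%:R^-1))).
  by apply: ler_sum => i _; exact: weight_le.
rewrite big_split /= sum_frequencies sumr_const card_ord -[_ *+ n]mulr_natl.
by rewrite divff ?gt_eqF.
Qed.

Lemma sum_weight_Sigma_le1 : \sum_(i < n | Sigma n nn i) q i <= 1.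
Proof.
rewrite -sum_frequencies big_mkcond /=; apply: ler_sum => i _.
rewrite /Sigma ltn_ord /=; case: ifPn => [/weight_le_pos//|_].
by rewrite divr_ge0 // ltW.
Qed.

Lemma powR2_opp_H S : 2 `^ (- H n nn t S) = \prod_(d <- degs S) q d.
Proof.
rewrite /H /degs big_map.
elim: (preorder S) => [|x s IH]; first by rewrite !big_nil oppr0 powRr0.
by rewrite !big_cons opprD powRD ?IH ?pnatr_eq0 ?implybT.
Qed.

End weights.

Theorem lemma3 (R : realType) (n : nat) (nn : nat -> nat) (t : R)
  (n_ge2 : (2 <= n)%N) (sum_nn : (\sum_(i < n) nn i)%N = n) (t_gt0 : 0 < t)
  (m : nat) (m_le_n : (m <= n)%N) (a : R) (a_ge0 : 0 <= a) :
  let trees := [set S : otree | [/\ nb_nodes S = m,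
                                    sigma_tree (Sigma n nn) S &
                                    H n nn t S = a]] in
  finite_set trees /\ #|` fset_set trees|%:R <= 2 `^ (a + 1).
Proof.
move=> trees.
have fin_trees : finite_set trees.
  by apply: sub_finite_set (finite_nb_nodes m) => S [].
split => //; set A := fset_set trees.
have AP S : S \in A -> trees S by rewrite in_fset_set // inE.
(* The witness [S0] excludes [m = 0], since every tree has a root. A positive [m] then splits into
   the root and its [m - 1] other nodes. *)
have [->|[S0 /AP[S0m _ _]]] := fset_0Vmem A.
  by rewrite cardfs0 powR_ge0.
case: m m_le_n @trees fin_trees @A AP S0m => [|m] m_le_n trees _ A AP.
  by case: S0.
move=> _.
have weightE : \sum_(S <- A) \prod_(d <- degs S) 2 `^ (- e n nn t d) =
    #|` A|%:R * 2 `^ (- a).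
  rewrite card_fset_sum1 natr_sum mulr_suml.
  by apply: eq_big_seq => S /AP[_ _ <-]; rewrite mul1r powR2_opp_H.
have := @sum_sigma_tree_le R (Sigma n nn) (fun i => 2 `^ (- e n nn t i))
  n m A (fun=> powR_ge0 _ _) m_le_n (fset_uniq _).
rewrite weightE => /(_ (fun S SA => let: And3 Sm Ss _ := AP S SA in conj Sm Ss)).
(* Multiplying through by [2 ^ a] leaves the total weight to be bounded by [2], which is the [+ 1]
   in the exponent. *)
rewrite powRN -ler_pdivlMr ?invr_gt0 ?powR_gt0 // invrK => /le_trans; apply.
rewrite powRD ?pnatr_eq0 ?implybT // powRr1 // mulrC ler_wpM2l ?powR_ge0 //.
have Sigma_ge0 : 0 <= \sum_(i < n | Sigma n nn i) 2 `^ (- e n nn t i).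
  by apply: sumr_ge0 => i _; exact: powR_ge0.
rewrite -[leRHS]mulr1 ler_pM ?exprn_ge0 ?sum_weight_le2 //.
  by apply: sumr_ge0 => i _; exact: powR_ge0.
by rewrite exprn_ile1 ?sum_weight_Sigma_le1.
Qed.
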